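(* Let $0\le k_1\le k_2$ be integers, $\mathbf{k}=(k_1,k_2)$, and put $s=\lfloor (k_2-k_1)/2\rfloor$. Then for all real $x$ with $0\le x<1$, $$ \Xi_2^{[\mathbf{k}]}(x)=\frac{\pi^2(1/2)_{k_1+k_2}(2x)^{k_1+k_2}}{4^{k_1+k_2+1}\,k_1!\,k_2!}\sum_{j=0}^{s}\frac{\left(\frac{k_1-k_2}{2}\right)_j\left(\frac{k_1-k_2+1}{2}\right)_j\left(k_1+k_2+\frac12\right)_{2j}x^{2j}}{(k_1+1)_j\,(k_2+1)_j\,(k_1+k_2+1)_j\,j!}\;F_j(x), $$ where $$ F_j(x)={}_3F_2\!\left(\tfrac12+j,\;k_1+\tfrac12+j,\;k_1+k_2+\tfrac12+2j;\;k_2+1+j,\;k_1+k_2+1+j;\;-x^2\right). $$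
   Context: For non-negative integers $k_1,k_2$, $\mathbf{k}=(k_1,k_2)$ and $0\le x<1$ the rank-2 function is defined by $$ \Xi_2^{[\mathbf{k}]}(x):=\frac14\int_0^{\pi}\!\!\int_0^{\pi}\frac{\cos(k_1\theta_1)\cos(k_2\theta_2)}{\sqrt{1+x^2-x(\cos\theta_1+\cos\theta_2)}}\,d\theta_1\,d\theta_2 . $$ Here $(a)_n=a(a+1)\cdots(a+n-1)$ with $(a)_0=1$ (in particular $(0)_0=1$) is the rising factorial, and ${}_3F_2(a_1,a_2,a_3;b_1,b_2;z)=\sum_{m\ge0}\frac{(a_1)_m(a_2)_m(a_3)_m}{(b_1)_m(b_2)_m\,m!}z^m$ (for $|z|<1$) is Clausen's generalized hypergeometric function. The convention $x^0=1$ (also at $x=0$) is used. *)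

(* Defs.v *)
From Stdlib Require Import Reals Arith.
From Coquelicot Require Import Coquelicot.

Open Scope R_scope.

Fixpoint rising (a : R) (n : nat) : R :=
  match n with
  | O => 1
  | S m => rising a m * (a + INR m)
  end.

(* PSeries is total; for |z| < 1 and b1, b2 not non-positive integers the series
   converges absolutely, so this is Clausen's 3F2. *)
Definition hyp3F2 (a1 a2 a3 b1 b2 z : R) : R :=
  PSeries (fun m : nat =>
    (rising a1 m * rising a2 m * rising a3 m) /
    (rising b1 m * rising b2 m * INR (fact m))) z.

(* For 0 <= x < 1 the radicand is at least (1 - x)^2 > 0, so the integrand is
   continuous and both integrals are genuine Riemann integrals. *)
Definition Xi2 (k1 k2 : nat) (x : R) : R :=
  / 4 * RInt (fun theta1 : R =>
          RInt (fun theta2 : R =>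
            (cos (INR k1 * theta1) * cos (INR k2 * theta2)) /
            sqrt (1 + x ^ 2 - x * (cos theta1 + cos theta2))) 0 PI) 0 PI.

(* Main.v *)
(* Write t = cos theta1 + cos theta2.  The integrand is the Legendre generating
   series sum_n P_n(t/2) x^n times a cosine weight, and |P_n| <= 1 on [-1, 1], so it
   may be integrated term by term for every x < 1.  The moments of t^n against the
   weight count lattice walks in Z^2, hence are products of two binomial
   coefficients, and the explicit form of P_n turns the coefficient of
   x^(k1+k2+2n) into a terminating balanced 4F3 at 1.  Whipple's transformation, i.e.
   the Pfaff-Saalschuetz sum applied twice, converts it into the coefficient of the
   stated combination of 3F2 series. *)

Require Import Defs.
From Stdlib Require Import Reals Arith ZArith Lra Lia.
From Coquelicot Require Import Coquelicot.

Open Scope R_scope.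

(** * Rising factorials and finite sums *)

(** Each P_n has to be integrated as a whole. Split into monomials and estimated termwise, its
    coefficients in absolute value sum to about (1 + sqrt 2)^n, so the interchange would stop at x <
    sqrt 2 - 1. The bound |P_n| <= 1 is therefore extracted from the three-term recurrence, and the
    recurrence is in turn checked on the explicit coefficients; one definition of P_n then serves
    the bound, the generating function and the moments.

    No double series is rearranged at the end. The sum over j is finite, so the right-hand side is a
    finite sum of convergent series in -x^2, the j-th shifted by j places to absorb x^(2j). Both
    sides become limits of the same partial sums once the coefficients of x^(k1+k2+2n) agree for
    each n. *)

Lemma rising_pos (a : R) (n : nat) : 0 < a -> 0 < rising a n.
Proof.
intros Ha; induction n as [|n IH]; simpl; [lra|].
apply Rmult_lt_0_compat; [exact IH|]; generalize (pos_INR n); lra.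
Qed.

Lemma rising_add (a : R) (m n : nat) :
  rising a (m + n) = rising a m * rising (a + INR m) n.
Proof.
induction n as [|n IH]; [rewrite Nat.add_0_r; simpl; ring|].
rewrite Nat.add_succ_r; simpl; rewrite IH, plus_INR; ring.
Qed.

(** Reversing the order of the factors turns each of them into minus a factor of the other
    product. *)
Lemma rising_reflect (a : R) (n : nat) :
  rising (1 - a - INR n) n = (-1) ^ n * rising a n.
Proof.
induction n as [|n IH]; [simpl; ring|].
replace (S n) with (1 + n)%nat at 2 by lia.
rewrite (rising_add _ 1 n).
replace (1 - a - INR (S n) + INR 1) with (1 - a - INR n)
  by (rewrite S_INR; simpl; ring).
rewrite IH, S_INR; simpl; ring.
Qed.

Lemma fact_rising (k n : nat) :
  INR (fact k) * rising (INR k + 1) n = INR (fact (k + n)).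
Proof.
induction n as [|n IH]; [rewrite Nat.add_0_r; simpl; ring|].
rewrite Nat.add_succ_r, fact_simpl, mult_INR, <- IH, S_INR, plus_INR; simpl; ring.
Qed.

(** Separating the factors of (k+1)...(k+2m) by parity gives two rising factorials of length m, the
    shape of numerator that [euler_coef] accepts. *)
Lemma rising_duplication (k m : nat) :
  INR (fact k) * (4 ^ m * rising ((INR k + 1) / 2) m * rising ((INR k + 2) / 2) m)
  = INR (fact (k + 2 * m)).
Proof.
induction m as [|m IH].
- rewrite Nat.mul_0_r, Nat.add_0_r; simpl; ring.
- replace (k + 2 * S m)%nat with (S (S (k + 2 * m))) by lia.
  rewrite 2!fact_simpl, 2!mult_INR, <- IH, !S_INR, plus_INR, mult_INR.
  simpl; field.
Qed.

(** A zero factor sits in the first product when r is even and in the second when r is odd. With r =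
    k2 - k1 this is what stops the sum over j at floor((k2-k1)/2). *)
Lemma rising_neg_pair_eq_0 (r j : nat) : (r < 2 * j)%nat ->
  rising (- INR r / 2) j * rising ((- INR r + 1) / 2) j = 0.
Proof.
intros H.
cut (exists i, (i < j)%nat /\ (- INR r / 2 + INR i = 0 \/ (- INR r + 1) / 2 + INR i = 0)).
- assert (Z : forall a i n, (i < n)%nat -> a + INR i = 0 -> rising a n = 0).
  { intros a i n Hi E; induction n as [|n IH]; [lia|]; simpl.
    destruct (Nat.eq_dec i n) as [->|Hne]; [rewrite E; ring|].
    rewrite IH by lia; ring. }
  intros [i [Hi [E|E]]]; [rewrite (Z _ i j Hi E)|rewrite (Z _ i j Hi E)]; ring.
- destruct (Nat.Even_or_Odd r) as [[i E]|[i E]]; exists i; split; try lia.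
  + left; rewrite E, mult_INR; simpl; field.
  + right; rewrite E, plus_INR, mult_INR; simpl; field.
Qed.

Lemma sum_f_R0_extend (f : nat -> R) (n m : nat) : (n <= m)%nat ->
  (forall i, (n < i <= m)%nat -> f i = 0) -> sum_f_R0 f m = sum_f_R0 f n.
Proof.
induction m as [|m IH]; intros Hle Hz; [replace n with O by lia; reflexivity|].
destruct (Nat.eq_dec n (S m)) as [->|Hne]; [reflexivity|].
rewrite tech5, Hz, Rplus_0_r by lia; apply IH; [lia|intros i Hi; apply Hz; lia].
Qed.

Lemma sum_f_R0_triangle (f : nat -> nat -> R) (n : nat) :
  sum_f_R0 (fun m => sum_f_R0 (fun j => f j (m - j)%nat) m) n =
  sum_f_R0 (fun j => sum_f_R0 (f j) (n - j)) n.
Proof.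
induction n as [|n IH]; [reflexivity|].
rewrite (tech5 (fun m => sum_f_R0 _ m)), IH.
rewrite (tech5 (fun j => f j (S n - j)%nat)), (tech5 (fun j => sum_f_R0 _ _)).
rewrite Nat.sub_diag, <- Rplus_assoc, <- sum_plus; f_equal.
apply sum_eq; intros j Hj.
now rewrite (Nat.sub_succ_l j n Hj), tech5.
Qed.

Lemma sum_f_R0_rev (f : nat -> R) (n : nat) :
  sum_f_R0 (fun i => f (n - i)%nat) n = sum_f_R0 f n.
Proof.
induction n as [|n IH]; [reflexivity|].
rewrite decomp_sum, tech5, Nat.sub_0_r, <- IH by lia; simpl; ring.
Qed.

Lemma sum_f_R0_sparse (f : nat -> R) (k n : nat) :
  (forall i, (forall m, i <> (k + 2 * m)%nat) -> f i = 0) ->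
  sum_f_R0 f (k + 2 * n) = sum_f_R0 (fun m => f (k + 2 * m)%nat) n.
Proof.
intros H; induction n as [|n IH].
- rewrite Nat.mul_0_r, Nat.add_0_r; simpl; rewrite Nat.add_0_r.
  destruct k as [|k]; [reflexivity|].
  rewrite tech5, sum_eq_R0; [ring|].
  intros i Hi; apply H; lia.
- rewrite tech5, <- IH.
  replace (k + 2 * S n)%nat with (S (S (k + 2 * n))) by lia.
  rewrite !tech5, (H (S (k + 2 * n))) by lia; ring.
Qed.

(** * The Pfaff-Saalschuetz sum and its consequences *)

Lemma telescope (g : nat -> R) (n : nat) :
  sum_f_R0 (fun j => g (S j) - g j) n = g (S n) - g O.
Proof. induction n as [|n IH]; [reflexivity|]; rewrite tech5, IH; ring. Qed.

(** The summand of 3F2(a, b, -n; c, 1+a+b-c-n; 1) multiplied by (c)_n (c-a-b)_n / n!. In this form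
    it is polynomial in a, b and c, so it also makes sense when c-a-b is a non-positive integer, as
    it is in [pfaff_saalschutz_half_integer]. *)
Definition saal_term (a b c : R) (n j : nat) : R :=
  rising a j * rising b j * rising (c + INR j) (n - j) *
  rising (c - a - b) (n - j) / (INR (fact j) * INR (fact (n - j))).

Lemma saal_term_top (a b c : R) (n j : nat) : 0 < c -> (j <= n)%nat ->
  (INR n + 1 - INR j) * saal_term a b c (S n) j =
  saal_term a b c n j * (c + INR n) * (c - a - b + INR n - INR j).
Proof.
intros Hc Hj; unfold saal_term.
replace (S n - j)%nat with (S (n - j)) by lia.
rewrite fact_simpl, mult_INR, S_INR, minus_INR by lia; simpl.
rewrite minus_INR by lia.
assert (INR j <= INR n) by (apply le_INR; lia).
field; repeat split; try apply INR_fact_neq_0; lra.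
Qed.

Lemma saal_term_shift (a b c : R) (n j : nat) : 0 < c -> (j <= n)%nat ->
  (INR j + 1) * (c + INR j) * saal_term a b c (S n) (S j) =
  saal_term a b c n j * (c + INR n) * (a + INR j) * (b + INR j).
Proof.
intros Hc Hj; unfold saal_term.
replace (S n - S j)%nat with (n - j)%nat by lia.
rewrite fact_simpl, mult_INR, S_INR.
assert (E : (c + INR j) * rising (c + (INR j + 1)) (n - j) =
            (c + INR n) * rising (c + INR j) (n - j)).
{ pose proof (rising_add (c + INR j) 1 (n - j)) as E1.
  replace (1 + (n - j))%nat with ((n - j) + 1)%nat in E1 by lia.
  rewrite (rising_add _ (n - j) 1), minus_INR in E1 by lia.
  simpl in E1.
  replace (c + (INR j + 1)) with (c + INR j + 1) by ring; lra. }
pose proof (pos_INR j).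
simpl rising at 1 2.
transitivity (rising a j * (a + INR j) * (rising b j * (b + INR j)) *
  ((c + INR j) * rising (c + (INR j + 1)) (n - j)) * rising (c - a - b) (n - j) /
  (INR (fact j) * INR (fact (n - j)))).
- field; repeat split; try apply INR_fact_neq_0; lra.
- rewrite E; field; repeat split; try apply INR_fact_neq_0; lra.
Qed.

Lemma pfaff_saalschutz (a b c : R) (n : nat) : 0 < c ->
  sum_f_R0 (saal_term a b c n) n =
  rising (c - a) n * rising (c - b) n / INR (fact n).
Proof.
intros Hc; induction n as [|n IH]; [unfold saal_term; simpl; field|].
(* (n+1) S_{n+1} splits Pascal-like into weights j and n+1-j; the defect from
   the factor (c-a+n)(c-b+n) telescopes. *)
set (T := saal_term a b c n) in *.
set (U := saal_term a b c (S n)).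
assert (HU : INR (S n) * sum_f_R0 U (S n) =
  sum_f_R0 (fun j => T j * (c + INR n) * (c - a - b + INR n - INR j)) n +
  sum_f_R0 (fun j => T j * (c + INR n) * (a + INR j) * (b + INR j) / (c + INR j)) n).
{ transitivity (sum_f_R0 (fun j => (INR n + 1 - INR j) * U j) (S n) +
                sum_f_R0 (fun j => INR j * U j) (S n)).
  - rewrite scal_sum, <- sum_plus; apply sum_eq; intros j _; rewrite S_INR; ring.
  - f_equal.
    + rewrite tech5, S_INR.
      replace ((INR n + 1 - (INR n + 1)) * U (S n)) with 0 by ring.
      rewrite Rplus_0_r; apply sum_eq; intros j Hj.
      now apply saal_term_top.
    + rewrite decomp_sum by lia; simpl pred.
      simpl INR at 1; rewrite Rmult_0_l, Rplus_0_l.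
      apply sum_eq; intros j Hj; pose proof (pos_INR j).
      unfold T; rewrite <- saal_term_shift by (lra || lia).
      fold U; rewrite S_INR; field; lra. }
(* The telescoping certificate: it vanishes at j = 0 through the factor j and at j = n+1 through the
   factor n+1-j. *)
set (G := fun j => INR j * (INR n + 1 - INR j) * U j / (c + INR n)).
pose proof (pos_INR n).
assert (HT : sum_f_R0 (fun j => T j * (c + INR n) * (c - a - b + INR n - INR j)) n +
  sum_f_R0 (fun j => T j * (c + INR n) * (a + INR j) * (b + INR j) / (c + INR j)) n =
  (c - a + INR n) * (c - b + INR n) * sum_f_R0 T n +
  sum_f_R0 (fun j => G (S j) - G j) n).
{ rewrite scal_sum, <- !sum_plus; apply sum_eq; intros j Hj.
  pose proof (pos_INR j).
  assert (G1 : G (S j) = (INR n - INR j) *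
            (T j * (c + INR n) * (a + INR j) * (b + INR j)) / (c + INR j) / (c + INR n)).
  { unfold T, G; rewrite <- saal_term_shift by (lra || lia).
    fold U; rewrite S_INR; field; lra. }
  assert (G0 : G j = INR j * (T j * (c + INR n) * (c - a - b + INR n - INR j)) / (c + INR n)).
  { unfold T, G; rewrite <- saal_term_top by (lra || lia).
    fold U; field; lra. }
  rewrite G1, G0; field; lra. }
assert (HG : sum_f_R0 (fun j => G (S j) - G j) n = 0).
{ rewrite telescope; unfold G; rewrite S_INR; simpl INR; field; lra. }
apply (Rmult_eq_reg_l (INR (S n))); [|apply not_0_INR; discriminate].
rewrite HU, HT, HG, IH, fact_simpl, mult_INR; simpl rising.
field; split; [apply INR_fact_neq_0|apply not_0_INR; discriminate].
Qed.

(** The coefficient of z^m in Euler's transformation 2F1(b,c;d;z) = (1-z)^(d-b-c) 2F1(d-b,d-c;d;z),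
    which is Pfaff-Saalschuetz with a and b replaced by d-b and d-c. *)
Lemma euler_coef (b c d : R) (m : nat) : 0 < d ->
  rising b m * rising c m / (rising d m * INR (fact m)) =
  sum_f_R0 (fun j => rising (d - b) j * rising (d - c) j / (INR (fact j) * rising d j) *
    (rising (b + c - d) (m - j) / INR (fact (m - j)))) m.
Proof.
intros Hd.
pose proof (pfaff_saalschutz (d - b) (d - c) d m Hd) as E.
replace (d - (d - b)) with b in E by ring.
replace (d - (d - c)) with c in E by ring.
pose proof (rising_pos d m Hd).
transitivity (/ rising d m * (rising b m * rising c m / INR (fact m))).
{ field; split; [apply INR_fact_neq_0|lra]. }
rewrite <- E, scal_sum; apply sum_eq; intros j Hj; unfold saal_term.
replace (d - (d - b) - (d - c)) with (b + c - d) by ring.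
replace (rising d m) with (rising d j * rising (d + INR j) (m - j))
  by (rewrite <- rising_add; f_equal; lia).
pose proof (rising_pos d j Hd).
assert (0 < rising (d + INR j) (m - j)).
{ apply rising_pos; pose proof (pos_INR j); lra. }
field; repeat split; try apply INR_fact_neq_0; lra.
Qed.

(** This is the inner sum that [coef_identity] leaves after the exchange of summations, with i the
    outer index and n the remaining length. Here c-a = 1/2-n-i and c-a-b = -(k2+n+i); reflecting
    both turns them into (1/2+i)_n and a quotient of factorials, and produces the signs. *)
Lemma pfaff_saalschutz_half_integer (k1 k2 i n : nat) :
  sum_f_R0 (fun l => (-1) ^ (n - l) * rising (1 / 2) (k1 + k2 + n + i + i + l) *
     rising (INR k2 + 1 / 2) l /
     (INR (fact (n - l)) * INR (fact l) * INR (fact (k1 + k2 + i + l)) *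
      INR (fact (k2 + i + l)))) n =
  (-1) ^ n * rising (1 / 2) (k1 + k2 + n + i + i) * rising (1 / 2 + INR i) n *
  rising (INR k1 + 1 / 2 + INR i) n /
  (INR (fact n) * INR (fact (k1 + k2 + i + n)) * INR (fact (k2 + i + n))).
Proof.
set (a := 1 / 2 + INR (k1 + k2 + n + i + i)).
set (b := INR k2 + 1 / 2).
set (c := INR (k1 + k2 + i) + 1).
assert (Hc : 0 < c) by (unfold c; pose proof (pos_INR (k1 + k2 + i)); lra).
pose proof (pfaff_saalschutz a b c n Hc) as E.
replace (rising (c - b) n) with (rising (INR k1 + 1 / 2 + INR i) n) in E
  by (f_equal; unfold b, c; rewrite !plus_INR; field).
replace (rising (c - a) n) with ((-1) ^ n * rising (1 / 2 + INR i) n) in E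
  by (rewrite <- rising_reflect; f_equal; unfold a, c; rewrite !plus_INR; field).
transitivity (rising (1 / 2) (k1 + k2 + n + i + i) /
  (INR (fact (k1 + k2 + i + n)) * INR (fact (k2 + i + n))) *
  ((-1) ^ n * rising (1 / 2 + INR i) n * rising (INR k1 + 1 / 2 + INR i) n / INR (fact n))).
2: field; repeat split; apply INR_fact_neq_0.
rewrite <- E, scal_sum; apply sum_eq; intros l Hl; unfold saal_term.
replace (rising (c - a - b) (n - l)) with
  ((-1) ^ (n - l) * rising (INR (k2 + i + l) + 1) (n - l))
  by (rewrite <- rising_reflect; f_equal; unfold a, b, c;
      rewrite minus_INR, !plus_INR by lia; field).
replace (c + INR l) with (INR (k1 + k2 + i + l) + 1)
  by (unfold c; rewrite !plus_INR; ring).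
replace (k1 + k2 + i + n)%nat with (k1 + k2 + i + l + (n - l))%nat by lia.
replace (k2 + i + n)%nat with (k2 + i + l + (n - l))%nat by lia.
rewrite <- (fact_rising (k1 + k2 + i + l)), <- (fact_rising (k2 + i + l)),
  (rising_add (1 / 2) (k1 + k2 + n + i + i) l); fold a b.
assert (P : forall p q, 0 < rising (INR p + 1) q)
  by (intros p q; apply rising_pos; pose proof (pos_INR p); lra).
pose proof (P (k1 + k2 + i + l)%nat (n - l)%nat).
pose proof (P (k2 + i + l)%nat (n - l)%nat).
field; repeat split; try apply INR_fact_neq_0; lra.
Qed.

(* Whipple's transformation of a balanced terminating 4F3: expand the factor
   (k1+k2+2m)!/(4^m m! (k1+m)!) by [euler_coef], then sum over m first. *)
Lemma coef_identity (k1 k2 n : nat) :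
  sum_f_R0 (fun m => (-1) ^ (n - m) * rising (1 / 2) (k1 + k2 + n + m) *
     INR (fact (k1 + k2 + 2 * m)) /
     (4 ^ m * INR (fact (n - m)) * INR (fact (k1 + k2 + m)) * INR (fact m) *
      INR (fact (k1 + m)) * INR (fact (k2 + m)))) n =
  rising (1 / 2) (k1 + k2) / (INR (fact k1) * INR (fact k2)) *
  sum_f_R0 (fun j =>
    (rising ((INR k1 - INR k2) / 2) j *
     rising ((INR k1 - INR k2 + 1) / 2) j *
     rising (INR k1 + INR k2 + 1 / 2) (2 * j)) /
    (rising (INR k1 + 1) j * rising (INR k2 + 1) j *
     rising (INR k1 + INR k2 + 1) j * INR (fact j)) *
    ((rising (1 / 2 + INR j) (n - j) * rising (INR k1 + 1 / 2 + INR j) (n - j) *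
      rising (INR k1 + INR k2 + 1 / 2 + 2 * INR j) (n - j)) /
     (rising (INR k2 + 1 + INR j) (n - j) * rising (INR k1 + INR k2 + 1 + INR j) (n - j) *
      INR (fact (n - j)))) * (-1) ^ (n - j)) n.
Proof.
assert (P : forall p q, 0 < rising (INR p + 1) q)
  by (intros p q; apply rising_pos; pose proof (pos_INR p); lra).
set (A := fun j => rising ((INR k1 - INR k2) / 2) j *
     rising ((INR k1 - INR k2 + 1) / 2) j / (INR (fact j) * rising (INR k1 + 1) j)).
set (F := fun j l => (-1) ^ (n - j - l) * rising (1 / 2) (k1 + k2 + n + j + l) *
     rising (INR k2 + 1 / 2) l /
     (INR (fact (n - j - l)) * INR (fact l) * INR (fact (k1 + k2 + j + l)) *
      INR (fact (k2 + j + l)))).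
transitivity (INR (fact (k1 + k2)) / INR (fact k1) *
   sum_f_R0 (fun m => sum_f_R0 (fun j => A j * F j (m - j)%nat) m) n).
- rewrite scal_sum; apply sum_eq; intros m Hm.
  (* The first two parameters come from [rising_duplication]. Pairing them with (k1+m)! rather than
     (k2+m)! makes the new numerator parameters (k1-k2)/2 and (k1-k2+1)/2, one of which terminates
     the sum when k1 <= k2; the remaining exponent b+c-d is k2+1/2. *)
  assert (E := euler_coef ((INR (k1 + k2) + 1) / 2) ((INR (k1 + k2) + 2) / 2) (INR k1 + 1) m).
  pose proof (pos_INR k1).
  specialize (E ltac:(lra)).
  pose proof (P k1 m).
  transitivity ((-1) ^ (n - m) * rising (1 / 2) (k1 + k2 + n + m) * INR (fact (k1 + k2)) /
     (INR (fact k1) * INR (fact (n - m)) * INR (fact (k1 + k2 + m)) * INR (fact (k2 + m))) *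
   (rising ((INR (k1 + k2) + 1) / 2) m * rising ((INR (k1 + k2) + 2) / 2) m /
      (rising (INR k1 + 1) m * INR (fact m)))).
  { rewrite <- (rising_duplication (k1 + k2) m), <- (fact_rising k1 m).
    field; repeat split; try apply INR_fact_neq_0; try lra.
    apply pow_nonzero; lra. }
  rewrite E, scal_sum, (Rmult_comm (sum_f_R0 _ _)), scal_sum.
  apply sum_eq; intros j Hj; unfold A, F.
  replace (n - j - (m - j))%nat with (n - m)%nat by lia.
  replace (k1 + k2 + n + j + (m - j))%nat with (k1 + k2 + n + m)%nat by lia.
  replace (k1 + k2 + j + (m - j))%nat with (k1 + k2 + m)%nat by lia.
  replace (k2 + j + (m - j))%nat with (k2 + m)%nat by lia.
  replace (INR k1 + 1 - (INR (k1 + k2) + 1) / 2) with ((INR k1 - INR k2 + 1) / 2)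
    by (rewrite plus_INR; field).
  replace (INR k1 + 1 - (INR (k1 + k2) + 2) / 2) with ((INR k1 - INR k2) / 2)
    by (rewrite plus_INR; field).
  replace ((INR (k1 + k2) + 1) / 2 + (INR (k1 + k2) + 2) / 2 - (INR k1 + 1))
    with (INR k2 + 1 / 2) by (rewrite plus_INR; field).
  pose proof (P k1 j).
  field; repeat split; try apply INR_fact_neq_0; lra.
- rewrite (sum_f_R0_triangle (fun j l => A j * F j l)), !scal_sum.
  apply sum_eq; intros j Hj.
  transitivity (A j * sum_f_R0 (F j) (n - j) * (INR (fact (k1 + k2)) / INR (fact k1))).
  { f_equal; rewrite scal_sum; apply sum_eq; intros l _; ring. }
  pose proof (pfaff_saalschutz_half_integer k1 k2 j (n - j)) as E.
  replace (k1 + k2 + (n - j) + j + j)%nat with (k1 + k2 + n + j)%nat in E by lia.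
  replace (k1 + k2 + j + (n - j))%nat with (k1 + k2 + n)%nat in E by lia.
  replace (k2 + j + (n - j))%nat with (k2 + n)%nat in E by lia.
  fold (F j) in E.
  assert (E' : sum_f_R0 (F j) (n - j) =
     (-1) ^ (n - j) * rising (1 / 2) (k1 + k2 + n + j) * rising (1 / 2 + INR j) (n - j) *
     rising (INR k1 + 1 / 2 + INR j) (n - j) /
     (INR (fact (n - j)) * INR (fact (k1 + k2 + n)) * INR (fact (k2 + n)))).
  { rewrite <- E; apply sum_eq; intros l Hl; unfold F.
    now replace (k1 + k2 + n + j + l)%nat with (k1 + k2 + (n - j) + j + j + l)%nat by lia. }
  rewrite E'.
  replace (k1 + k2 + n + j)%nat with ((k1 + k2) + (2 * j + (n - j)))%nat by lia.
  replace (k1 + k2 + n)%nat with ((k1 + k2) + (j + (n - j)))%nat by lia.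
  replace (k2 + n)%nat with (k2 + (j + (n - j)))%nat by lia.
  rewrite <- (fact_rising (k1 + k2)), <- (fact_rising k2), !rising_add, mult_INR, !plus_INR.
  replace (1 / 2 + (INR k1 + INR k2)) with (INR k1 + INR k2 + 1 / 2) by ring.
  simpl (INR 2).
  replace (1 + 1) with 2 by ring.
  pose proof (P k1 j); pose proof (P k2 j); pose proof (P (k1 + k2)%nat j).
  rewrite plus_INR in *.
  assert (0 < rising (INR k2 + 1 + INR j) (n - j)).
  { apply rising_pos; pose proof (pos_INR j); pose proof (pos_INR k2); lra. }
  assert (0 < rising (INR k1 + INR k2 + 1 + INR j) (n - j)).
  { apply rising_pos; pose proof (pos_INR j); pose proof (pos_INR k1);
    pose proof (pos_INR k2); lra. }
  unfold A.
  field; repeat split; try apply INR_fact_neq_0; lra.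
Qed.

(** * Legendre polynomials *)

(** In powers of t = 2u the coefficients of P_n(u) carry no powers of 2. The guard matters because
    truncated subtraction would give nonzero values for 2i > n; with it the sum may run to any bound
    from n on. *)
Definition leg_coef (n i : nat) : R :=
  if (2 * i <=? n)%nat then
    (-1) ^ i * rising (1 / 2) (n - i) / (INR (fact i) * INR (fact (n - 2 * i)))
  else 0.

(* The Legendre polynomial P_n evaluated at t / 2. *)
Definition leg (n : nat) (t : R) : R :=
  sum_f_R0 (fun i => leg_coef n i * t ^ (n - 2 * i)) n.

Lemma leg_coef_eq (i l : nat) :
  leg_coef (2 * i + l) i =
  (-1) ^ i * rising (1 / 2) (i + l) / (INR (fact i) * INR (fact l)).
Proof.
unfold leg_coef; rewrite (proj2 (Nat.leb_le _ _)) by lia.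
now replace (2 * i + l - i)%nat with (i + l)%nat by lia;
  replace (2 * i + l - 2 * i)%nat with l by lia.
Qed.

Lemma leg_coef_eq_0 (n i : nat) : (n < 2 * i)%nat -> leg_coef n i = 0.
Proof. intros H; unfold leg_coef; now rewrite (proj2 (Nat.leb_gt _ _)). Qed.

Lemma leg_extend (n m : nat) (t : R) : (n <= m)%nat ->
  leg n t = sum_f_R0 (fun i => leg_coef n i * t ^ (n - 2 * i)) m.
Proof.
intros H; symmetry; apply sum_f_R0_extend; [exact H|].
intros i Hi; rewrite leg_coef_eq_0 by lia; ring.
Qed.

Lemma leg_coef_rec_0 (n : nat) (t : R) :
  (INR n + 2) * (leg_coef (S (S n)) 0 * t ^ (S (S n) - 2 * 0)) =
  (INR n + 3 / 2) * t * (leg_coef (S n) 0 * t ^ (S n - 2 * 0)).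
Proof.
change (leg_coef (S (S n)) 0) with (leg_coef (2 * 0 + S (S n)) 0).
change (leg_coef (S n) 0) with (leg_coef (2 * 0 + S n) 0).
rewrite !leg_coef_eq, Nat.mul_0_r, !Nat.sub_0_r.
rewrite !Nat.add_0_l, (fact_simpl (S n)), mult_INR.
pose proof (pos_INR n); cbn [rising pow]; rewrite !S_INR; simpl (fact 0); simpl (INR 1).
field; split; [apply INR_fact_neq_0|lra].
Qed.

Lemma leg_coef_rec_S (n i : nat) (t : R) :
  (INR n + 2) * (leg_coef (S (S n)) (S i) * t ^ (S (S n) - 2 * S i)) =
  (INR n + 3 / 2) * t * (leg_coef (S n) (S i) * t ^ (S n - 2 * S i))
  - (INR n + 1) * (leg_coef n i * t ^ (n - 2 * i)).
Proof.
(* For n < 2i all three coefficients vanish; for n = 2i only the middle one does; for n > 2i all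
   three are given by the formula. *)
destruct (Nat.lt_trichotomy n (2 * i)) as [H|[H|H]].
- rewrite !leg_coef_eq_0 by lia; ring.
- rewrite (leg_coef_eq_0 (S n)) by lia.
  pose proof (leg_coef_eq i 0) as E0; pose proof (leg_coef_eq (S i) 0) as E1.
  replace (2 * i + 0)%nat with n in E0 by lia.
  replace (2 * S i + 0)%nat with (S (S n)) in E1 by lia.
  rewrite E0, E1.
  replace (S (S n) - 2 * S i)%nat with O by lia; replace (n - 2 * i)%nat with O by lia.
  rewrite !Nat.add_0_r, (fact_simpl i), mult_INR, H, S_INR, mult_INR.
  pose proof (pos_INR i); simpl.
  field; split; [apply INR_fact_neq_0|lra].
- destruct (Nat.le_exists_sub (S (2 * i)) n H) as [l [E _]].
  pose proof (leg_coef_eq i (S l)) as E0; pose proof (leg_coef_eq (S i) l) as E1.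
  pose proof (leg_coef_eq (S i) (S l)) as E2.
  replace (2 * i + S l)%nat with n in E0 by lia.
  replace (2 * S i + l)%nat with (S n) in E1 by lia.
  replace (2 * S i + S l)%nat with (S (S n)) in E2 by lia.
  rewrite E0, E1, E2.
  replace (S (S n) - 2 * S i)%nat with (S l) by lia.
  replace (S n - 2 * S i)%nat with l by lia.
  replace (n - 2 * i)%nat with (S l) by lia.
  replace (S i + S l)%nat with (S (S (i + l))) by lia.
  replace (S i + l)%nat with (S (i + l)) by lia.
  replace (i + S l)%nat with (S (i + l)) by lia.
  replace (INR n) with (INR l + 1 + 2 * INR i)
    by (rewrite E, plus_INR, S_INR, mult_INR; simpl; ring).
  rewrite (fact_simpl i), (fact_simpl l), !mult_INR.
  pose proof (pos_INR i); pose proof (pos_INR l).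
  cbn [rising pow]; rewrite !S_INR, !plus_INR.
  field; repeat split; try apply INR_fact_neq_0; lra.
Qed.

(** Bonnet's recurrence for u = t/2. Term i of [leg n] meets term i+1 of the two higher polynomials,
    hence the different upper limits of the extended sums. *)
Lemma leg_rec (n : nat) (t : R) :
  (INR n + 2) * leg (S (S n)) t =
  (INR n + 3 / 2) * t * leg (S n) t - (INR n + 1) * leg n t.
Proof.
rewrite (leg_extend (S n) (S (S n)) t), (leg_extend n (S n) t) by lia; unfold leg.
rewrite !(decomp_sum _ (S (S n))) by lia; simpl pred.
rewrite !Rmult_plus_distr_l, leg_coef_rec_0, !scal_sum.
unfold Rminus; rewrite Rplus_assoc; f_equal.
replace (- sum_f_R0 (fun i => leg_coef n i * t ^ (n - 2 * i) * (INR n + 1)) (S n))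
  with (-1 * sum_f_R0 (fun i => leg_coef n i * t ^ (n - 2 * i) * (INR n + 1)) (S n))
  by ring.
rewrite scal_sum, <- sum_plus; apply sum_eq; intros i _.
rewrite Rmult_comm, leg_coef_rec_S; ring.
Qed.

Lemma leg_0 (t : R) : leg 0 t = 1.
Proof. unfold leg, leg_coef; simpl; field. Qed.

Lemma leg_1 (t : R) : leg 1 t = t / 2.
Proof. unfold leg, leg_coef; simpl; field. Qed.

(* With u = t/2, the quadratic form a^2 - 2uab + b^2 decreases along consecutive values. *)
Lemma leg_energy (t : R) (n : nat) :
  (leg (S n) t - t / 2 * leg n t) ^ 2 + (1 - (t / 2) ^ 2) * leg n t ^ 2 <= 1 - (t / 2) ^ 2.
Proof.
induction n as [|n IH]; [rewrite leg_0, leg_1; simpl; lra|].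
set (u := t / 2) in *.
apply Rle_trans with (2 := IH).
(* The form in (P_n, P_{n+1}) is symmetric, so it can be completed to a square around P_{n+1}, the
   value shared with the next form. The two forms then differ in one square only, which the
   recurrence multiplies by r^2 <= 1. *)
set (r := (INR n + 1) / (INR n + 2)).
pose proof (pos_INR n) as Hn.
assert (E : leg (S (S n)) t - u * leg (S n) t = - r * (leg n t - u * leg (S n) t)).
{ apply (Rmult_eq_reg_l (INR n + 2)); [|lra].
  rewrite Rmult_minus_distr_l, leg_rec; unfold r, u; field; lra. }
assert (Hr : 0 <= r <= 1).
{ unfold r; split; [apply Rlt_le, Rdiv_lt_0_compat; lra|].
  apply (Rmult_le_reg_r (INR n + 2)); [lra|]; field_simplify; lra. }
rewrite E.
assert (r ^ 2 * (leg n t - u * leg (S n) t) ^ 2 <= 1 * (leg n t - u * leg (S n) t) ^ 2).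
{ apply Rmult_le_compat_r; [apply pow2_ge_0|nra]. }
nra.
Qed.

Lemma leg_bound (t : R) (n : nat) : -2 <= t <= 2 -> Rabs (leg n t) <= 1.
Proof.
intros Ht.
assert (Hu : (t / 2) ^ 2 <= 1) by nra.
cut (leg n t ^ 2 <= 1).
{ intros H; apply Rabs_le; nra. }
destruct (Rle_lt_or_eq_dec _ _ Hu) as [H|H].
- pose proof (leg_energy t n) as E.
  pose proof (pow2_ge_0 (leg (S n) t - t / 2 * leg n t)).
  apply (Rmult_le_reg_l (1 - (t / 2) ^ 2)); lra.
(* At u^2 = 1 the form degenerates and bounds nothing, but its vanishing forces P_{n+1} = u P_n, so
   the squares stay equal to 1. *)
- induction n as [|n IH]; [rewrite leg_0; lra|].
  pose proof (leg_energy t n) as E; rewrite H in E.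
  assert (E' : leg (S n) t - t / 2 * leg n t = 0) by nra.
  replace (leg (S n) t) with (t / 2 * leg n t) by lra.
  rewrite Rpow_mult_distr, H; lra.
Qed.

(** * The Legendre generating function and its tail *)

Lemma leg_radius (t y : R) : -2 <= t <= 2 -> Rabs y < 1 ->
  Rbar_lt (Rabs y) (CV_radius (fun n => leg n t)).
Proof.
intros Ht Hy.
apply Rbar_lt_le_trans with (Finite 1); [exact Hy|].
apply CV_radius_bounded.
exists 1; intros n; rewrite pow1, Rmult_1_r; now apply leg_bound.
Qed.

(** The recurrence read as a differential equation, the one satisfied by (1 + y^2 - yt)^(-1/2). *)
Lemma leg_ode (t y : R) : -2 <= t <= 2 -> Rabs y < 1 ->
  (1 + y ^ 2 - y * t) * PSeries (PS_derive (fun n => leg n t)) y =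
  (t / 2 - y) * PSeries (fun n => leg n t) y.
Proof.
intros Ht Hy.
set (a := fun n => leg n t).
assert (Ha : is_pseries a y (PSeries a y)).
{ apply PSeries_correct, CV_radius_inside, leg_radius; assumption. }
assert (Hd : is_pseries (PS_derive a) y (PSeries (PS_derive a) y)).
{ apply PSeries_correct, CV_radius_inside; rewrite CV_radius_derive.
  apply leg_radius; assumption. }
set (S0 := PSeries a y) in *; set (S1 := PSeries (PS_derive a) y) in *.
assert (M : forall c b l, is_pseries b y l -> is_pseries (PS_scal c b) y (c * l)).
{ intros c b l H; apply (is_pseries_scal c b y l (Rmult_comm _ _) H). }
pose proof (is_pseries_incr_1 _ _ _ Hd) as Hd1.
pose proof (is_pseries_incr_1 _ _ _ Hd1) as Hd2.
pose proof (is_pseries_incr_1 _ _ _ Ha) as Ha1.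
pose proof (is_pseries_plus _ _ _ _ _ Hd
  (is_pseries_plus _ _ _ _ _ (M (- t) _ _ Hd1)
  (is_pseries_plus _ _ _ _ _ Hd2
  (is_pseries_plus _ _ _ _ _ (M (- (t / 2)) _ _ Ha) Ha1)))) as H.
apply is_pseries_unique in H.
rewrite (PSeries_ext _ (fun _ => 0)), PSeries_const_0 in H.
- unfold plus, scal in H; simpl in H; unfold mult in H; simpl in H.
  apply Rminus_diag_uniq; rewrite H; ring.
- intros n; unfold PS_plus, PS_scal, PS_incr_1, PS_derive, a.
  unfold plus, scal, zero; simpl; unfold mult, zero; simpl.
  (* Coefficient 0 only involves [leg_0] and [leg_1]; coefficient 1 is the recurrence at 0, and
     coefficient n+2 the recurrence at n+1. *)
  destruct n as [|[|n]].
  + rewrite leg_0, leg_1; simpl; field.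
  + pose proof (leg_rec 0 t) as R0; rewrite leg_0, leg_1 in *; simpl in *; lra.
  + pose proof (leg_rec (S n) t) as R0; rewrite !S_INR in *; simpl in *.
    change (match n with O => 1 | S _ => INR n + 1 end) with (INR (S n)); rewrite S_INR; lra.
Qed.

Lemma gen_radicand_pos (t y : R) : -2 <= t <= 2 -> Rabs y < 1 -> 0 < 1 + y ^ 2 - y * t.
Proof.
intros Ht Hy; apply Rabs_def2 in Hy.
destruct (Rle_dec 0 y); nra.
Qed.

(** By [leg_ode] the product of the series and the square root has derivative zero on [0, x], and it
    equals 1 at 0. *)
Lemma leg_gen (t x : R) : -2 <= t <= 2 -> 0 <= x < 1 ->
  PSeries (fun n => leg n t) x = / sqrt (1 + x ^ 2 - x * t).
Proof.
intros Ht Hx.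
set (S0 := PSeries (fun n => leg n t)).
assert (C : S0 0 * sqrt (1 + 0 ^ 2 - 0 * t) = S0 x * sqrt (1 + x ^ 2 - x * t)).
{ destruct (Req_dec x 0) as [->|Hx0]; [reflexivity|].
  apply (eq_is_derive (fun y => S0 y * sqrt (1 + y ^ 2 - y * t))); [|lra].
  intros y Hy.
  assert (Hy1 : Rabs y < 1) by (apply Rabs_def1; lra).
  pose proof (gen_radicand_pos t y Ht Hy1) as Hp.
  pose proof (sqrt_lt_R0 _ Hp) as Hs.
  assert (D1 : is_derive (fun y => sqrt (1 + y ^ 2 - y * t)) y
                 ((2 * y - t) / (2 * sqrt (1 + y ^ 2 - y * t)))).
  { auto_derive; [exact Hp|].
    replace (1 + y * (y * 1) + - (y * t)) with (1 + y ^ 2 - y * t) by ring.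
    field; lra. }
  pose proof (is_derive_PSeries _ _ (leg_radius t y Ht Hy1)) as D0.
  pose proof (is_derive_mult _ _ _ _ _ D0 D1 Rmult_comm) as D.
  refine (eq_ind _ (fun l => is_derive _ y l) D _ _).
  change (PSeries (PS_derive (fun n => leg n t)) y * sqrt (1 + y ^ 2 - y * t) +
    S0 y * ((2 * y - t) / (2 * sqrt (1 + y ^ 2 - y * t))) = 0).
  pose proof (leg_ode t y Ht Hy1) as O; fold S0 in O.
  pose proof (sqrt_sqrt _ (Rlt_le _ _ Hp)) as Q.
  set (r := sqrt (1 + y ^ 2 - y * t)) in *.
  set (S1 := PSeries (PS_derive (fun n => leg n t)) y) in *.
  rewrite <- Q in O.
  apply (Rmult_eq_reg_r r); [|lra].
  transitivity (r * r * S1 - (t / 2 - y) * S0 y); [field; lra|rewrite O; ring]. }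
replace (1 + 0 ^ 2 - 0 * t) with 1 in C by ring.
rewrite sqrt_1, Rmult_1_r in C; unfold S0 at 1 in C; rewrite PSeries_0, leg_0 in C.
assert (Hx1 : Rabs x < 1) by (apply Rabs_def1; lra).
pose proof (sqrt_lt_R0 _ (gen_radicand_pos t x Ht Hx1)).
apply (Rmult_eq_reg_r (sqrt (1 + x ^ 2 - x * t))); [|lra].
rewrite <- C; field; lra.
Qed.

(** The bound is free of t: it serves as the uniform error under both integrals. *)
Lemma leg_tail (t x : R) (n : nat) : -2 <= t <= 2 -> 0 <= x < 1 ->
  Rabs (sum_f_R0 (fun i => leg i t * x ^ i) n - / sqrt (1 + x ^ 2 - x * t))
  <= x ^ S n / (1 - x).
Proof.
intros Ht Hx.
assert (Hx1 : Rabs x < 1) by (apply Rabs_def1; lra).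
rewrite <- (leg_gen t x Ht Hx); unfold PSeries.
assert (Hex : ex_series (fun i => leg i t * x ^ i)).
{ apply ex_pseries_R, CV_radius_inside, leg_radius; assumption. }
rewrite (Series_incr_n _ (S n)) by (lia || exact Hex); simpl pred.
set (f := fun k => leg (S n + k) t * x ^ (S n + k)).
assert (B : forall k, 0 <= Rabs (f k) <= x ^ S n * x ^ k).
{ intros k; split; [apply Rabs_pos|]; unfold f.
  rewrite Rabs_mult, <- pow_add, (Rabs_pos_eq (x ^ _)) by (apply pow_le; lra).
  rewrite <- (Rmult_1_l (x ^ (S n + k))) at 2.
  apply Rmult_le_compat_r; [apply pow_le; lra|now apply leg_bound]. }
assert (G : ex_series (fun k => x ^ S n * x ^ k)).
{ exact (ex_series_scal_l (V := R_NormedModule) (x ^ S n) _ (ex_series_geom x Hx1)). }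
replace (_ - _) with (- Series f) by ring.
rewrite Rabs_Ropp.
apply Rle_trans with (Series (fun k => Rabs (f k))).
- apply Series_Rabs.
  apply (ex_series_le (fun k => Rabs (f k)) (fun k => x ^ S n * x ^ k)); [|exact G].
  intros k; unfold norm; simpl; unfold abs; simpl; rewrite Rabs_Rabsolu; apply B.
- unfold Rdiv; rewrite <- (Series_geom x Hx1), <- Series_scal_l.
  now apply Series_le.
Qed.

(** * Double integrals and moments *)

(** Existence and value of the iterated integral travel together, so sums, multiples and uniform
    limits need no separate integrability argument. *)
Definition is_RInt2 (f : R -> R -> R) (v : R) : Prop :=
  exists g, (forall s, is_RInt (f s) 0 PI (g s)) /\ is_RInt g 0 PI v.

Lemma is_RInt2_ext (f g : R -> R -> R) (v : R) :
  (forall s t, f s t = g s t) -> is_RInt2 f v -> is_RInt2 g v.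
Proof.
intros E [h [H1 H2]]; exists h; split; [|exact H2].
intros s; apply (is_RInt_ext (f s)); [intros; apply E|apply H1].
Qed.

Lemma is_RInt2_unique (f : R -> R -> R) (v : R) :
  is_RInt2 f v -> RInt (fun s => RInt (f s) 0 PI) 0 PI = v.
Proof.
intros [g [H1 H2]]; apply is_RInt_unique, (is_RInt_ext g); [|exact H2].
intros s _; symmetry; apply is_RInt_unique, H1.
Qed.

Lemma is_RInt2_0 (f : R -> R -> R) : (forall s t, f s t = 0) -> is_RInt2 f 0.
Proof.
intros H; apply (is_RInt2_ext (fun _ _ => 0)); [intros; now rewrite H|].
assert (Z : is_RInt (fun _ => 0) 0 PI 0).
{ refine (eq_ind _ (is_RInt (fun _ => 0) 0 PI) (is_RInt_const 0 PI 0) _ _).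
  apply Rmult_0_r. }
now exists (fun _ => 0).
Qed.

Lemma is_RInt2_plus (f g : R -> R -> R) (v w : R) :
  is_RInt2 f v -> is_RInt2 g w -> is_RInt2 (fun s t => f s t + g s t) (v + w).
Proof.
intros [h [H1 H2]] [k [K1 K2]]; exists (fun s => h s + k s); split.
- intros s; exact (is_RInt_plus _ _ _ _ _ _ (H1 s) (K1 s)).
- exact (is_RInt_plus _ _ _ _ _ _ H2 K2).
Qed.

Lemma is_RInt2_scal (c : R) (f : R -> R -> R) (v : R) :
  is_RInt2 f v -> is_RInt2 (fun s t => c * f s t) (c * v).
Proof.
intros [h [H1 H2]]; exists (fun s => c * h s); split.
- intros s; exact (is_RInt_scal _ _ _ c _ (H1 s)).
- exact (is_RInt_scal _ _ _ c _ H2).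
Qed.

Lemma is_RInt2_sum (f : nat -> R -> R -> R) (v : nat -> R) (n : nat) :
  (forall i, (i <= n)%nat -> is_RInt2 (f i) (v i)) ->
  is_RInt2 (fun s t => sum_f_R0 (fun i => f i s t) n) (sum_f_R0 v n).
Proof.
induction n as [|n IH]; intros H; [apply H; lia|].
exact (is_RInt2_plus _ _ _ _ (IH (fun i Hi => H i (le_S _ _ Hi))) (H _ (le_n _))).
Qed.

Lemma is_RInt2_mult (f g : R -> R) (v w : R) :
  is_RInt f 0 PI v -> is_RInt g 0 PI w -> is_RInt2 (fun s t => f s * g t) (v * w).
Proof.
intros Hf Hg; exists (fun s => f s * w); split.
- intros s; exact (is_RInt_scal _ _ _ (f s) _ Hg).
- rewrite Rmult_comm; apply (is_RInt_ext (fun s => w * f s)); [intros; apply Rmult_comm|].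
  exact (is_RInt_scal _ _ _ w _ Hf).
Qed.

(** The error bound is asked for all real t because [filterlim_RInt] takes convergence in the
    uniform space of functions on the whole line. *)
Lemma is_RInt_lim (f : nat -> R -> R) (g : R -> R) (h e : nat -> R) :
  is_lim_seq e 0 -> (forall n t, Rabs (f n t - g t) <= e n) ->
  (forall n, is_RInt (f n) 0 PI (h n)) ->
  exists v : R, is_lim_seq h v /\ is_RInt g 0 PI v.
Proof.
intros He Hfg Hf.
apply (filterlim_RInt f 0 PI eventually _ g h Hf).
apply filterlim_locally; intros eps.
apply is_lim_seq_spec in He; destruct (He eps) as [N HN].
exists N; intros n Hn t.
apply Rle_lt_trans with (1 := Hfg n t).
specialize (HN n Hn); rewrite Rminus_0_r in HN.
now apply Rle_lt_trans with (1 := Rle_abs _).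
Qed.

Lemma is_RInt2_lim (f : nat -> R -> R -> R) (g : R -> R -> R) (v e : nat -> R) :
  is_lim_seq e 0 -> (forall n s t, Rabs (f n s t - g s t) <= e n) ->
  (forall n, is_RInt2 (f n) (v n)) ->
  exists w : R, is_lim_seq v w /\ is_RInt2 g w.
Proof.
intros He Hfg Hf.
assert (Hin : forall n, exists h, (forall s, is_RInt (f n s) 0 PI (h s)) /\ is_RInt h 0 PI (v n))
  by exact Hf.
(* The hypothesis yields an inner integral for each n separately; [RInt] names them all as one
   function of n and s. *)
set (h := fun n s => RInt (f n s) 0 PI).
assert (H1 : forall n s, is_RInt (f n s) 0 PI (h n s)).
{ intros n s; destruct (Hin n) as [k [K _]]; unfold h.
  now rewrite (is_RInt_unique _ _ _ _ (K s)). }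
assert (H2 : forall n, is_RInt (h n) 0 PI (v n)).
{ intros n; destruct (Hin n) as [k [K1 K2]].
  apply (is_RInt_ext k); [|exact K2].
  intros s _; symmetry; apply is_RInt_unique, K1. }
set (k := fun s => RInt (g s) 0 PI).
assert (K : forall s, is_lim_seq (fun n => h n s) (k s) /\ is_RInt (g s) 0 PI (k s)).
{ intros s.
  destruct (is_RInt_lim (fun n => f n s) (g s) (fun n => h n s) e He
     (fun n => Hfg n s) (fun n => H1 n s)) as [w [W1 W2]].
  unfold k; now rewrite (is_RInt_unique _ _ _ _ W2). }
(* Integrating the error over [0, PI] keeps it uniform in s, so the one-variable limit applies again
   to the outer integral. *)
assert (B : forall n s, Rabs (h n s - k s) <= PI * e n).
{ intros n s.
  pose proof (is_RInt_minus _ _ _ _ _ _ (H1 n s) (proj2 (K s))) as M.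
  replace (PI * e n) with ((PI - 0) * e n) by ring.
  exact (norm_RInt_le_const (fun t => minus (f n s t) (g s t)) 0 PI _ (e n)
    (Rlt_le _ _ PI_RGT_0) (fun t _ => Hfg n s t) M). }
destruct (is_RInt_lim h k v (fun n => PI * e n)) as [w [W1 W2]].
- replace (Finite 0) with (Rbar_mult PI 0) by (simpl; f_equal; ring).
  now apply is_lim_seq_scal_l.
- exact B.
- exact H2.
- exists w; split; [exact W1|].
  exists k; split; [intros s; apply K|exact W2].
Qed.

(** Binomial coefficients with an integer lower index, zero outside 0..n, so that Pascal's rule and
    the walk recursion hold without boundary cases. *)
Fixpoint binomZ (n : nat) (p : Z) : R :=
  match n with
  | O => if (p =? 0)%Z then 1 else 0
  | S m => binomZ m p + binomZ m (p - 1)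
  end.

Lemma binomZ_neg (n : nat) (p : Z) : (p < 0)%Z -> binomZ n p = 0.
Proof.
revert p; induction n as [|n IH]; intros p Hp; simpl.
- now rewrite (proj2 (Z.eqb_neq p 0)) by lia.
- rewrite !IH by lia; ring.
Qed.

Lemma binomZ_gt (n : nat) (p : Z) : (Z.of_nat n < p)%Z -> binomZ n p = 0.
Proof.
revert p; induction n as [|n IH]; intros p Hp; cbn [binomZ].
- now rewrite (proj2 (Z.eqb_neq p 0)) by lia.
- rewrite !IH by lia; ring.
Qed.

Lemma binomZ_fact (q r : nat) :
  binomZ (q + r) (Z.of_nat q) = INR (fact (q + r)) / (INR (fact q) * INR (fact r)).
Proof.
remember (q + r)%nat as n eqn:E; revert q r E.
induction n as [|n IH]; intros q r E.
- replace q with O by lia; replace r with O by lia; simpl; field.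
- cbn [binomZ]; destruct q as [|q].
  + replace r with (S n) by lia.
    rewrite binomZ_neg with (p := (Z.of_nat 0 - 1)%Z), (IH O n) by lia.
    simpl (INR (fact 0)); field; split; apply INR_fact_neq_0.
  + replace (Z.of_nat (S q) - 1)%Z with (Z.of_nat q) by lia.
    rewrite (IH q r) by lia.
    destruct r as [|r].
    * rewrite binomZ_gt by lia; replace (S q) with (S n) by lia; replace q with n by lia.
      simpl (INR (fact 0)); field; split; apply INR_fact_neq_0.
    * rewrite (IH (S q) r), (fact_simpl q), (fact_simpl r), (fact_simpl n), !mult_INR by lia.
      replace (S n) with (S q + S r)%nat by lia.
      rewrite plus_INR; pose proof (pos_INR q); pose proof (pos_INR r); rewrite !S_INR.
      field; repeat split; try apply INR_fact_neq_0; lra.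
Qed.

Lemma sin_IZR_PI (a : Z) : sin (IZR a * PI) = 0.
Proof. apply sin_eq_0_1; now exists a. Qed.

Lemma is_RInt_cos (a : Z) :
  is_RInt (fun t => cos (IZR a * t)) 0 PI (if (a =? 0)%Z then PI else 0).
Proof.
destruct (Z.eqb_spec a 0) as [->|Ha].
- apply (is_RInt_ext (fun _ => 1)).
  + intros t _; now rewrite Rmult_0_l, cos_0.
  + replace PI with ((PI - 0) * 1) at 2 by ring.
    apply (is_RInt_const 0 PI 1).
- assert (Ha' : IZR a <> 0) by now apply eq_IZR_contrapositive.
  replace 0 with (sin (IZR a * PI) / IZR a - sin (IZR a * 0) / IZR a) at 2
    by (rewrite sin_IZR_PI, Rmult_0_r, sin_0; field; exact Ha').
  apply (is_RInt_derive (fun t => sin (IZR a * t) / IZR a)).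
  + intros t _; auto_derive; [exact I|field; exact Ha'].
  + intros t _; apply (ex_derive_continuous (fun t => cos (IZR a * t))).
    auto_derive; exact I.
Qed.

Lemma cos_mult_cos (u v : R) : cos u * cos v = (cos (v + u) + cos (v - u)) / 2.
Proof. rewrite cos_plus, cos_minus; field. Qed.

(* The moment counts the n-step walks from 0 to (a, b) in Z^2; in the rotated
   coordinates both components are independent one-dimensional walks. *)
Lemma moment (n : nat) (a b : Z) :
  (forall p, (Z.of_nat n + a + b = 2 * p)%Z ->
    is_RInt2 (fun s t => (cos s + cos t) ^ n * (cos (IZR a * s) * cos (IZR b * t)))
      (PI ^ 2 / 2 ^ n * (binomZ n p * binomZ n (p - b)))) /\
  (forall p, (Z.of_nat n + a + b = 2 * p + 1)%Z ->
    is_RInt2 (fun s t => (cos s + cos t) ^ n * (cos (IZR a * s) * cos (IZR b * t))) 0).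
Proof.
revert a b; induction n as [|n IH]; intros a b.
- pose proof (is_RInt2_mult _ _ _ _ (is_RInt_cos a) (is_RInt_cos b)) as H.
  split; intros p Hp;
  apply (is_RInt2_ext (fun s t => cos (IZR a * s) * cos (IZR b * t)));
    try (intros; simpl; ring).
  + replace (_ * _) with ((if (a =? 0)%Z then PI else 0) * (if (b =? 0)%Z then PI else 0));
      [exact H|].
    simpl binomZ.
    destruct (Z.eqb_spec a 0), (Z.eqb_spec b 0), (Z.eqb_spec p 0), (Z.eqb_spec (p - b) 0);
      try lia; simpl; field.
  + replace 0 with ((if (a =? 0)%Z then PI else 0) * (if (b =? 0)%Z then PI else 0));
      [exact H|].
    destruct (Z.eqb_spec a 0), (Z.eqb_spec b 0); try lia; ring.
- set (F := fun n a b s t => (cos s + cos t) ^ n * (cos (IZR a * s) * cos (IZR b * t))).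
  (* Product-to-sum formulas turn multiplication by cos s + cos t into half the sum over the four
     unit steps in Z^2. *)
  assert (E : forall s t, / 2 * (F n (a + 1)%Z b s t + F n (a - 1)%Z b s t +
     (F n a (b + 1)%Z s t + F n a (b - 1)%Z s t)) = F (S n) a b s t).
  { intros s t; unfold F; simpl pow.
    rewrite !plus_IZR, !minus_IZR.
    pose proof (cos_mult_cos s (IZR a * s)) as C1; pose proof (cos_mult_cos t (IZR b * t)) as C2.
    replace ((IZR a + 1) * s) with (IZR a * s + s) by ring.
    replace ((IZR a - 1) * s) with (IZR a * s - s) by ring.
    replace ((IZR b + 1) * t) with (IZR b * t + t) by ring.
    replace ((IZR b - 1) * t) with (IZR b * t - t) by ring.
    replace ((cos s + cos t) * (cos s + cos t) ^ n * (cos (IZR a * s) * cos (IZR b * t)))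
      with ((cos s + cos t) ^ n * ((cos s * cos (IZR a * s)) * cos (IZR b * t)
            + cos (IZR a * s) * (cos t * cos (IZR b * t)))) by ring.
    rewrite C1, C2; field. }
  assert (H : forall v1 v2 v3 v4, is_RInt2 (F n (a + 1)%Z b) v1 -> is_RInt2 (F n (a - 1)%Z b) v2 ->
     is_RInt2 (F n a (b + 1)%Z) v3 -> is_RInt2 (F n a (b - 1)%Z) v4 ->
     is_RInt2 (F (S n) a b) (/ 2 * (v1 + v2 + (v3 + v4)))).
  { intros v1 v2 v3 v4 H1 H2 H3 H4; apply (is_RInt2_ext _ _ _ E).
    exact (is_RInt2_scal _ _ _ (is_RInt2_plus _ _ _ _ (is_RInt2_plus _ _ _ _ H1 H2)
      (is_RInt2_plus _ _ _ _ H3 H4))). }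
  split; intros p Hp.
  + eapply eq_ind; [apply H|].
    * apply (proj1 (IH (a + 1)%Z b) p); lia.
    * apply (proj1 (IH (a - 1)%Z b) (p - 1)%Z); lia.
    * apply (proj1 (IH a (b + 1)%Z) p); lia.
    * apply (proj1 (IH a (b - 1)%Z) (p - 1)%Z); lia.
    (* The four products add up to (B(p) + B(p-1)) (B(p-b) + B(p-b-1)) with B = [binomZ n], and
       Pascal's rule applies to each factor. *)
    * replace (p - 1 - (b - 1))%Z with (p - b)%Z by lia.
      replace (p - 1 - b)%Z with (p - b - 1)%Z by lia.
      replace (p - (b + 1))%Z with (p - b - 1)%Z by lia.
      cbn [binomZ pow]; field; apply pow_nonzero; lra.
  + replace 0 with (/ 2 * (0 + 0 + (0 + 0))) by field.
    apply H; [apply (proj2 (IH (a + 1)%Z b) p)|apply (proj2 (IH (a - 1)%Z b) (p - 1)%Z)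
             |apply (proj2 (IH a (b + 1)%Z) p)|apply (proj2 (IH a (b - 1)%Z) (p - 1)%Z)]; lia.
Qed.

(** * Power series of Xi2 *)

(** Aligns the j-th hypergeometric series, which starts at x^(2j), with the common index n of
    x^(2n). *)
Lemma is_series_shift (a : nat -> R) (l : R) (j : nat) :
  is_series a l -> is_series (fun n => if (j <=? n)%nat then a (n - j)%nat else 0) l.
Proof.
intros H; destruct j as [|j].
- apply (is_series_ext a); [intros n; now rewrite Nat.sub_0_r|exact H].
- set (b := fun n => if (S j <=? n)%nat then a (n - S j)%nat else 0).
  assert (Z : sum_n b (pred (S j)) = 0).
  { rewrite sum_n_Reals; apply (sum_eq_R0 b).
    intros n Hn; unfold b; now rewrite (proj2 (Nat.leb_gt _ _)) by (simpl in Hn; lia). }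
  apply (is_series_decr_n b (S j) l); [lia|].
  apply (is_series_ext a).
  + intros n; unfold b; rewrite (proj2 (Nat.leb_le _ _)) by lia; f_equal; lia.
  + refine (eq_ind l (is_series a) H _ _).
    change (l = l + - @sum_n R_AbelianMonoid b (pred (S j))); rewrite Z; ring.
Qed.

Lemma is_series_sum (a : nat -> nat -> R) (l : nat -> R) (n : nat) :
  (forall j, (j <= n)%nat -> is_series (a j) (l j)) ->
  is_series (fun i => sum_f_R0 (fun j => a j i) n) (sum_f_R0 l n).
Proof.
induction n as [|n IH]; intros H; [apply H; lia|].
exact (is_series_plus _ _ _ _ (IH (fun i Hi => H i (le_S _ _ Hi))) (H _ (le_n _))).
Qed.

Lemma is_lim_seq_ratio (a b : R) : 0 < b ->
  is_lim_seq (fun n => (a + INR n) / (b + INR n)) 1.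
Proof.
intros Hb.
apply is_lim_seq_ext with (fun n => 1 + (a - b) * / (b + INR n)).
{ intros n; pose proof (pos_INR n); field; lra. }
replace (Finite 1) with (Finite (1 + (a - b) * 0)) by (f_equal; ring).
apply is_lim_seq_plus'; [apply is_lim_seq_const|].
apply is_lim_seq_mult'; [apply is_lim_seq_const|].
replace (Finite 0) with (Rbar_inv p_infty) by reflexivity.
apply is_lim_seq_inv; [|discriminate].
apply (is_lim_seq_plus _ _ b p_infty); [apply is_lim_seq_const|apply is_lim_seq_INR|reflexivity].
Qed.

Lemma hyp3F2_is_series (a1 a2 a3 b1 b2 z : R) :
  0 < a1 -> 0 < a2 -> 0 < a3 -> 0 < b1 -> 0 < b2 -> Rabs z < 1 ->
  is_series (fun m => (rising a1 m * rising a2 m * rising a3 m) /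
    (rising b1 m * rising b2 m * INR (fact m)) * z ^ m) (hyp3F2 a1 a2 a3 b1 b2 z).
Proof.
intros H1 H2 H3 H4 H5 Hz.
apply is_pseries_R, PSeries_correct, CV_radius_inside.
assert (Hp : forall m, 0 < (rising a1 m * rising a2 m * rising a3 m) /
    (rising b1 m * rising b2 m * INR (fact m))).
{ intros m; apply Rdiv_lt_0_compat; repeat apply Rmult_lt_0_compat;
    try (now apply rising_pos); apply INR_fact_lt_0. }
rewrite (CV_radius_finite_DAlembert _ 1).
- now rewrite Rinv_1.
- intros m; pose proof (Hp m); lra.
- lra.
(* The ratio of consecutive coefficients splits into three quotients tending to 1; the factorial
   supplies the third denominator 1 + m. *)
- apply is_lim_seq_ext with (fun m => (a1 + INR m) / (b1 + INR m) *
    ((a2 + INR m) / (b2 + INR m)) * ((a3 + INR m) / (1 + INR m))).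
  + intros m.
    rewrite Rabs_pos_eq by (apply Rlt_le, Rdiv_lt_0_compat; apply Hp).
    rewrite fact_simpl, mult_INR, S_INR; cbn [rising].
    pose proof (pos_INR m); pose proof (rising_pos a1 m H1); pose proof (rising_pos a2 m H2).
    pose proof (rising_pos a3 m H3); pose proof (rising_pos b1 m H4).
    pose proof (rising_pos b2 m H5).
    field; repeat split; try apply INR_fact_neq_0; lra.
  + replace (Finite 1) with (Finite (1 * 1 * 1)) by (f_equal; ring).
    repeat apply is_lim_seq_mult'; apply is_lim_seq_ratio; lra.
Qed.

Definition weight (k1 k2 : nat) (s t : R) : R := cos (INR k1 * s) * cos (INR k2 * t).

Lemma moment_weight (k1 k2 m : nat) :
  is_RInt2 (fun s t => (cos s + cos t) ^ (k1 + k2 + 2 * m) * weight k1 k2 s t)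
    (PI ^ 2 / 2 ^ (k1 + k2 + 2 * m) * (INR (fact (k1 + k2 + 2 * m)) ^ 2 /
     (INR (fact (k1 + k2 + m)) * INR (fact m) * INR (fact (k1 + m)) * INR (fact (k2 + m))))).
Proof.
pose proof (proj1 (moment (k1 + k2 + 2 * m) (Z.of_nat k1) (Z.of_nat k2))
  (Z.of_nat (k1 + k2 + m)) ltac:(lia)) as H.
replace (Z.of_nat (k1 + k2 + m) - Z.of_nat k2)%Z with (Z.of_nat (k1 + m)) in H by lia.
rewrite <- !INR_IZR_INZ in H.
pose proof (binomZ_fact (k1 + k2 + m) m) as B1; pose proof (binomZ_fact (k1 + m) (k2 + m)) as B2.
replace (k1 + k2 + m + m)%nat with (k1 + k2 + 2 * m)%nat in B1 by lia.
replace (k1 + m + (k2 + m))%nat with (k1 + k2 + 2 * m)%nat in B2 by lia.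
rewrite B1, B2 in H.
eapply eq_ind; [exact H|].
field; repeat split; try apply INR_fact_neq_0; apply pow_nonzero; lra.
Qed.

Lemma moment_weight_0 (k1 k2 l : nat) : (forall m, l <> (k1 + k2 + 2 * m)%nat) ->
  is_RInt2 (fun s t => (cos s + cos t) ^ l * weight k1 k2 s t) 0.
Proof.
intros Hl.
pose proof (moment l (Z.of_nat k1) (Z.of_nat k2)) as [H0 H1].
rewrite <- !INR_IZR_INZ in H0, H1.
(* With the right parity l must be smaller than k1 + k2, so the walk is too short to reach (k1, k2);
   with the wrong parity the moment vanishes outright. *)
destruct (Nat.Even_or_Odd (l + k1 + k2)) as [[p Hp]|[p Hp]].
- specialize (H0 (Z.of_nat p) ltac:(lia)).
  assert (l < p)%nat.
  { apply Nat.nle_gt; intros Hle; apply (Hl (l - p)%nat); lia. }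
  rewrite binomZ_gt, Rmult_0_l, Rmult_0_r in H0 by lia; exact H0.
- exact (H1 (Z.of_nat p) ltac:(lia)).
Qed.

Lemma leg_weight_sum (k1 k2 n : nat) (v : nat -> R) :
  (forall i, (2 * i <= n)%nat ->
    is_RInt2 (fun s t => leg_coef n i * ((cos s + cos t) ^ (n - 2 * i) * weight k1 k2 s t))
      (v i)) ->
  (forall i, (n < 2 * i)%nat -> v i = 0) ->
  is_RInt2 (fun s t => leg n (cos s + cos t) * weight k1 k2 s t) (sum_f_R0 v n).
Proof.
intros H H0.
apply (is_RInt2_ext (fun s t => sum_f_R0 (fun i =>
  leg_coef n i * ((cos s + cos t) ^ (n - 2 * i) * weight k1 k2 s t)) n)).
{ intros s t; unfold leg; rewrite (Rmult_comm (sum_f_R0 _ _)), scal_sum.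
  apply sum_eq; intros; ring. }
apply is_RInt2_sum; intros i _.
destruct (Nat.le_gt_cases (2 * i) n) as [Hi|Hi]; [now apply H|].
rewrite H0 by exact Hi; apply is_RInt2_0; intros s t.
rewrite leg_coef_eq_0 by exact Hi; ring.
Qed.

Lemma leg_moment_0 (k1 k2 n : nat) : (forall m, n <> (k1 + k2 + 2 * m)%nat) ->
  is_RInt2 (fun s t => leg n (cos s + cos t) * weight k1 k2 s t) 0.
Proof.
intros Hn.
replace 0 with (sum_f_R0 (fun _ => 0) n) by (apply sum_eq_R0; reflexivity).
apply leg_weight_sum; [|reflexivity].
intros i Hi; rewrite <- (Rmult_0_r (leg_coef n i)); apply is_RInt2_scal, moment_weight_0.
intros m E; apply (Hn (m + i)%nat); lia.
Qed.

(* The coefficient of x^(k1+k2+2n) up to the factor PI^2 / 2^(k1+k2). *)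
Definition leg_moment_coef (k1 k2 n : nat) : R :=
  sum_f_R0 (fun m => (-1) ^ (n - m) * rising (1 / 2) (k1 + k2 + n + m) *
     INR (fact (k1 + k2 + 2 * m)) /
     (4 ^ m * INR (fact (n - m)) * INR (fact (k1 + k2 + m)) * INR (fact m) *
      INR (fact (k1 + m)) * INR (fact (k2 + m)))) n.

Lemma leg_moment (k1 k2 n : nat) :
  is_RInt2 (fun s t => leg (k1 + k2 + 2 * n) (cos s + cos t) * weight k1 k2 s t)
    (PI ^ 2 / 2 ^ (k1 + k2) * leg_moment_coef k1 k2 n).
Proof.
set (c := fun m => (-1) ^ (n - m) * rising (1 / 2) (k1 + k2 + n + m) *
     INR (fact (k1 + k2 + 2 * m)) /
     (4 ^ m * INR (fact (n - m)) * INR (fact (k1 + k2 + m)) * INR (fact m) *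
      INR (fact (k1 + m)) * INR (fact (k2 + m))) * (PI ^ 2 / 2 ^ (k1 + k2))).
(* Term i of the Legendre polynomial has degree k1+k2+2(n-i), so m = n-i. For i > n the degree is
   below k1+k2 and the moment is zero. One factor (k1+k2+2m)! of the moment cancels against the
   denominator of [leg_coef]. *)
set (v := fun i => if (i <=? n)%nat then c (n - i)%nat else 0).
replace (PI ^ 2 / 2 ^ (k1 + k2) * leg_moment_coef k1 k2 n)
  with (sum_f_R0 v (k1 + k2 + 2 * n)).
2:{ rewrite (sum_f_R0_extend v n); [|lia|].
  - unfold leg_moment_coef; rewrite scal_sum; fold c; rewrite <- (sum_f_R0_rev c).
    apply sum_eq; intros i Hi; unfold v; now rewrite (proj2 (Nat.leb_le _ _) Hi).
  - intros i Hi; unfold v; now rewrite (proj2 (Nat.leb_gt _ _)) by lia. }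
apply leg_weight_sum.
- intros i Hi; unfold v; destruct (Nat.leb_spec i n) as [Hin|Hin].
  + pose proof (is_RInt2_scal (leg_coef (k1 + k2 + 2 * n) i) _ _
      (moment_weight k1 k2 (n - i))) as H.
    replace (k1 + k2 + 2 * n - 2 * i)%nat with (k1 + k2 + 2 * (n - i))%nat by lia.
    eapply eq_ind; [exact H|]; unfold c.
    pose proof (leg_coef_eq i (k1 + k2 + 2 * (n - i))) as E.
    replace (2 * i + (k1 + k2 + 2 * (n - i)))%nat with (k1 + k2 + 2 * n)%nat in E by lia.
    replace (i + (k1 + k2 + 2 * (n - i)))%nat with (k1 + k2 + n + (n - i))%nat in E by lia.
    rewrite E; replace (n - (n - i))%nat with i by lia.
    rewrite (pow_add 2 (k1 + k2)), (pow_mult 2 2).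
    replace (2 ^ 2) with 4 by ring.
    field; repeat split; try apply INR_fact_neq_0; apply pow_nonzero; lra.
  + rewrite <- (Rmult_0_r (leg_coef (k1 + k2 + 2 * n) i)).
    apply is_RInt2_scal, moment_weight_0; intros m; lia.
- intros i Hi; unfold v; destruct (Nat.leb_spec i n) as [Hin|Hin]; [lia|reflexivity].
Qed.

Lemma Xi2_is_lim_seq (k1 k2 : nat) (x : R) : 0 <= x < 1 ->
  is_lim_seq (fun n => / 4 * (PI ^ 2 / 2 ^ (k1 + k2) * x ^ (k1 + k2)) *
      sum_f_R0 (fun m => leg_moment_coef k1 k2 m * x ^ (2 * m)) n)
    (Xi2 k1 k2 x).
Proof.
intros Hx.
set (q := fun n => RInt (fun s => RInt (fun t =>
  leg n (cos s + cos t) * weight k1 k2 s t) 0 PI) 0 PI).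
assert (Hq0 : forall n, (forall m, n <> (k1 + k2 + 2 * m)%nat) -> q n = 0).
{ intros n Hn; exact (is_RInt2_unique _ _ (leg_moment_0 k1 k2 n Hn)). }
assert (Hq1 : forall n, q (k1 + k2 + 2 * n)%nat =
  PI ^ 2 / 2 ^ (k1 + k2) * leg_moment_coef k1 k2 n).
{ intros n; exact (is_RInt2_unique _ _ (leg_moment k1 k2 n)). }
assert (Hq : forall n, is_RInt2 (fun s t => leg n (cos s + cos t) * weight k1 k2 s t) (q n)).
{ intros n.
  assert (Hc : (exists m, n = (k1 + k2 + 2 * m)%nat) \/ forall m, n <> (k1 + k2 + 2 * m)%nat).
  { destruct (Nat.Even_or_Odd (n - (k1 + k2))) as [[p Hp]|[p Hp]].
    - destruct (Nat.le_gt_cases (k1 + k2) n); [left; exists p; lia|right; lia].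
    - right; lia. }
  destruct Hc as [[m ->]|Hn].
  - rewrite Hq1; apply leg_moment.
  - rewrite Hq0 by exact Hn; now apply leg_moment_0. }
set (g := fun s t => (cos (INR k1 * s) * cos (INR k2 * t)) /
  sqrt (1 + x ^ 2 - x * (cos s + cos t))).
destruct (is_RInt2_lim
  (fun n s t => sum_f_R0 (fun i => x ^ i * (leg i (cos s + cos t) * weight k1 k2 s t)) n)
  g (fun n => sum_f_R0 (fun i => x ^ i * q i) n) (fun n => x ^ S n / (1 - x)))
  as [w [W1 W2]].
- replace (Finite 0) with (Rbar_mult 0 (/ (1 - x))) by (simpl; f_equal; ring).
  apply is_lim_seq_scal_r, (is_lim_seq_incr_1 (fun n => x ^ n)), is_lim_seq_geom.
  rewrite Rabs_pos_eq; lra.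
- intros n s t.
  pose proof (COS_bound s); pose proof (COS_bound t).
  pose proof (leg_tail (cos s + cos t) x n ltac:(lra) Hx) as T.
  replace (_ - g s t) with
    ((sum_f_R0 (fun i => leg i (cos s + cos t) * x ^ i) n
      - / sqrt (1 + x ^ 2 - x * (cos s + cos t))) * weight k1 k2 s t).
  2:{ rewrite Rmult_minus_distr_r; f_equal.
      - rewrite Rmult_comm, scal_sum; apply sum_eq; intros; ring.
      - unfold g, weight, Rdiv; ring. }
  rewrite Rabs_mult; apply Rle_trans with (2 := T).
  rewrite <- (Rmult_1_r (Rabs (_ - _))) at 2.
  apply Rmult_le_compat_l; [apply Rabs_pos|].
  unfold weight; rewrite Rabs_mult, <- (Rmult_1_r 1).
  apply Rmult_le_compat; try apply Rabs_pos; apply Rabs_le, COS_bound.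
- intros n; apply is_RInt2_sum; intros i _; apply is_RInt2_scal, Hq.
- unfold Xi2; fold g.
  change (RInt _ 0 PI) with (RInt (fun s => RInt (g s) 0 PI) 0 PI).
  rewrite (is_RInt2_unique _ _ W2).
  (* Stopping at degree k1+k2+2n leaves exactly the n+1 terms of the required partial sum, the other
     degrees contributing zero. *)
  apply (is_lim_seq_subseq _ _ (fun n => (k1 + k2 + 2 * n)%nat)) in W1;
    [|apply eventually_subseq; intros n; lia].
  apply (is_lim_seq_scal_l _ (/ 4)) in W1.
  revert W1; apply is_lim_seq_ext; intros n.
  rewrite sum_f_R0_sparse by (intros i Hi; rewrite Hq0 by exact Hi; ring).
  rewrite Rmult_assoc; f_equal; rewrite scal_sum; apply sum_eq; intros m _.
  rewrite Hq1, pow_add; ring.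
Qed.

Theorem theorem2 (k1 k2 : nat) (hk : (k1 <= k2)%nat) (x : R)
    (hx : 0 <= x < 1) :
  Xi2 k1 k2 x =
  (PI ^ 2 * rising (1 / 2) (k1 + k2) * (2 * x) ^ (k1 + k2)) /
    (4 ^ (k1 + k2 + 1) * INR (fact k1) * INR (fact k2)) *
  sum_f_R0 (fun j : nat =>
    (rising ((INR k1 - INR k2) / 2) j *
     rising ((INR k1 - INR k2 + 1) / 2) j *
     rising (INR k1 + INR k2 + 1 / 2) (2 * j) *
     x ^ (2 * j)) /
    (rising (INR k1 + 1) j * rising (INR k2 + 1) j *
     rising (INR k1 + INR k2 + 1) j * INR (fact j)) *
    hyp3F2 (1 / 2 + INR j)
           (INR k1 + 1 / 2 + INR j)
           (INR k1 + INR k2 + 1 / 2 + 2 * INR j)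
           (INR k2 + 1 + INR j)
           (INR k1 + INR k2 + 1 + INR j)
           (- x ^ 2))
    ((k2 - k1) / 2)%nat.
Proof.
set (A := fun j => (rising ((INR k1 - INR k2) / 2) j *
     rising ((INR k1 - INR k2 + 1) / 2) j *
     rising (INR k1 + INR k2 + 1 / 2) (2 * j)) /
    (rising (INR k1 + 1) j * rising (INR k2 + 1) j *
     rising (INR k1 + INR k2 + 1) j * INR (fact j))).
set (b := fun j m =>
  (rising (1 / 2 + INR j) m * rising (INR k1 + 1 / 2 + INR j) m *
   rising (INR k1 + INR k2 + 1 / 2 + 2 * INR j) m) /
  (rising (INR k2 + 1 + INR j) m * rising (INR k1 + INR k2 + 1 + INR j) m * INR (fact m))).
set (F := fun j => hyp3F2 (1 / 2 + INR j) (INR k1 + 1 / 2 + INR j)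
   (INR k1 + INR k2 + 1 / 2 + 2 * INR j) (INR k2 + 1 + INR j)
   (INR k1 + INR k2 + 1 + INR j) (- x ^ 2)).
set (s := ((k2 - k1) / 2)%nat).
assert (HA : forall j, (s < j)%nat -> A j = 0).
{ intros j Hj; unfold A, Rdiv.
  replace (INR k1 - INR k2) with (- INR (k2 - k1)) by (rewrite minus_INR by exact hk; ring).
  pose proof (rising_neg_pair_eq_0 (k2 - k1) j) as Z; unfold Rdiv in Z.
  rewrite Z; [ring|].
  pose proof (Nat.div_mod_eq (k2 - k1) 2); pose proof (Nat.mod_upper_bound (k2 - k1) 2).
  unfold s in Hj; lia. }
assert (HF : forall j, is_series (fun n => if (j <=? n)%nat
     then A j * x ^ (2 * j) * (b j (n - j)%nat * (- x ^ 2) ^ (n - j)) else 0)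
     (A j * x ^ (2 * j) * F j)).
{ intros j.
  apply (is_series_shift (fun m => A j * x ^ (2 * j) * (b j m * (- x ^ 2) ^ m))).
  apply (is_series_scal_l (V := R_NormedModule) (A j * x ^ (2 * j))).
  pose proof (pos_INR j); pose proof (pos_INR k1); pose proof (pos_INR k2).
  apply hyp3F2_is_series; try lra.
  rewrite Rabs_Ropp, Rabs_pos_eq by apply pow2_ge_0; nra. }
pose proof (is_series_sum _ _ s (fun j _ => HF j)) as HS.
set (c0 := rising (1 / 2) (k1 + k2) / (INR (fact k1) * INR (fact k2))).
assert (HC : forall n, leg_moment_coef k1 k2 n * x ^ (2 * n) =
  c0 * sum_f_R0 (fun j => if (j <=? n)%nat
     then A j * x ^ (2 * j) * (b j (n - j)%nat * (- x ^ 2) ^ (n - j)) else 0) s).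
{ intros n; unfold leg_moment_coef; rewrite coef_identity; fold c0.
  rewrite Rmult_assoc; f_equal.
  (* One sum stops at n, the other at s. Both extend to s+n: beyond n the guard gives zero, and
     beyond s the factor [A j] vanishes. *)
  rewrite <- (sum_f_R0_extend _ s (s + n)), (sum_f_R0_extend _ n (s + n)); try lia.
  - rewrite Rmult_comm, scal_sum; apply sum_eq; intros j Hj.
    rewrite (proj2 (Nat.leb_le _ _) Hj); fold (A j); fold (b j (n - j)%nat).
    replace (- x ^ 2) with (-1 * x ^ 2) by ring.
    rewrite Rpow_mult_distr, <- pow_mult.
    replace (2 * n)%nat with (2 * j + 2 * (n - j))%nat by lia.
    rewrite pow_add; ring.
  - intros j Hj; now rewrite (proj2 (Nat.leb_gt _ _)) by lia.
  - intros j Hj; rewrite HA by lia; destruct (j <=? n)%nat; ring. }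
pose proof (Xi2_is_lim_seq k1 k2 x hx) as HX.
set (L := sum_f_R0 (fun j => A j * x ^ (2 * j) * F j) s) in *.
assert (HL : is_lim_seq (fun n => / 4 * (PI ^ 2 / 2 ^ (k1 + k2) * x ^ (k1 + k2)) *
      sum_f_R0 (fun m => leg_moment_coef k1 k2 m * x ^ (2 * m)) n)
   (/ 4 * (PI ^ 2 / 2 ^ (k1 + k2) * x ^ (k1 + k2)) * (c0 * L))).
{ apply (is_lim_seq_scal_l _ _ (c0 * L)).
  apply (is_lim_seq_ext (fun n => c0 * sum_n (fun n => sum_f_R0 (fun j => if (j <=? n)%nat
     then A j * x ^ (2 * j) * (b j (n - j)%nat * (- x ^ 2) ^ (n - j)) else 0) s) n)).
  - intros n; rewrite sum_n_Reals, scal_sum; apply sum_eq; intros m _; rewrite HC; ring.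
  - exact (is_lim_seq_scal_l _ c0 L HS). }
(* [HX] and [HL] give limits of the same sequence, hence the same value. *)
apply is_lim_seq_unique in HX; apply is_lim_seq_unique in HL.
rewrite HX in HL; injection HL as HL; rewrite HL.
replace (sum_f_R0 _ s) with L.
- unfold c0; rewrite Rpow_mult_distr, (pow_add 4 (k1 + k2) 1).
  replace (4 ^ (k1 + k2)) with (2 ^ (k1 + k2) * 2 ^ (k1 + k2))
    by (rewrite <- Rpow_mult_distr; f_equal; ring).
  field; repeat split; try apply INR_fact_neq_0; apply pow_nonzero; lra.
- apply sum_eq; intros j _; unfold A, F, Rdiv; ring.
Qed.
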